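(* Let $k$ be a positive integer and let $G$ be an edge-colored graph on $n$ vertices such that $m(G)+c(G)\geq \binom{n+1}{2}+k-1$. Then $G$ contains (at least) $k$ rainbow triangles.
   Context: Graphs are finite, simple, undirected and have at least one vertex. An edge-colored graph is a graph together with an arbitrary (not necessarily proper) assignment of a color to each edge. $m(G)$ denotes the number of edges of $G$, and $c(G)$ denotes the number of distinct colors that actually appear on the edges of $G$. A subgraph is rainbow if all its edges have pairwise distinct colors; a rainbow triangle is a rainbow subgraph isomorphic to $K_3$, and rainbow triangles are counted as distinct subgraphs (i.e. by their vertex sets). *)

(* Defs.v *)
From HB Require Import structures.
From mathcomp Require Import all_boot.
Set Implicit Arguments.
Unset Strict Implicit.
Unset Printing Implicit Defensive.

Record sgraph (V : finType) := SGraph {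
  adj :> rel V;
  adj_sym : symmetric adj;
  adj_irrefl : irreflexive adj
}.

Definition edges (V : finType) (G : sgraph V) : {set {set V}} :=
  [set E : {set V} | [exists x, exists y, G x y && (E == [set x; y])]].

(* [color] is total on vertex sets for convenience; only its values on edges
   matter: [rainbow] is applied to sets of edges of the underlying graph. *)
Record edge_colored_graph (V : finType) (C : eqType) := EdgeColoredGraph {
  underlying :> sgraph V;
  color : {set V} -> C
}.

Definition num_edges (V : finType) (G : sgraph V) : nat := #|edges G|.

Definition num_colors (V : finType) (C : eqType)
    (G : edge_colored_graph V C) : nat :=
  size (undup [seq color G E | E in edges G]).

Definition rainbow (V : finType) (C : eqType) (G : edge_colored_graph V C)
    (F : {set {set V}}) : bool :=
  [forall E in F, forall E' in F, (E != E') ==> (color G E != color G E')].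

(* A subgraph isomorphic to K_3 is determined by its vertex set S: three
   pairwise adjacent vertices. *)
Definition triangle (V : finType) (G : sgraph V) (S : {set V}) : bool :=
  (#|S| == 3) && [forall x in S, forall y in S, (x != y) ==> G x y].

Definition edges_within (V : finType) (G : sgraph V) (S : {set V}) :
    {set {set V}} :=
  [set E in edges G | E \subset S].

Definition rainbow_triangles (V : finType) (C : eqType)
    (G : edge_colored_graph V C) : {set {set V}} :=
  [set S : {set V} | triangle G S && rainbow G (edges_within G S)].

(* Main.v *)
Require Import Defs.
From mathcomp Require Import all_boot zify.

(** If no rainbow triangle exists then m + c < 'C(n + 1, 2), by induction on n.
    For a vertex v let s(v) be the number of colors lost by deleting v. Some v
    has d(v) + s(v) <= n, and deleting it completes the induction. Otherwise
    choose v with s(v) maximal and, for each color lost, one neighbor joined to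
    v in that color. These s(v) neighbors are pairwise non-adjacent, since two
    adjacent ones would span a rainbow triangle with v. Hence each such neighbor
    a has d(a) <= n - s(v), so s(a) > s(v), a contradiction.

    For k > 1, take an edge E of a rainbow triangle. If its color occurs
    elsewhere, delete E; otherwise recolor E with the color of another edge of
    the triangle. Either way m + c drops by at most 1, at least one rainbow
    triangle is lost and none is created. *)

(** * Edge sets as sets of pairs, with colors in a finite type *)

Section Sets.

Context {V T : finType}.
Implicit Types (M : {set {set V}}) (f : {set V} -> T) (S U E : {set V}).

Definition pairs_of S : {set {set V}} := [set E : {set V} | E \subset S & #|E| == 2].

Definition rainbow_triples M f : {set {set V}} :=
  [set S : {set V} | [&& #|S| == 3, pairs_of S \subset M &
                         #|f @: pairs_of S| == #|pairs_of S|]].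

(** Deleting a vertex is modelled by shrinking [U], so that [V] and [M] stay fixed during the
    induction. *)
Definition inside M U : {set {set V}} := [set E in M | E \subset U].

Definition neighbors M U v : {set V} := [set x in U | [set v; x] \in M].

Definition lost_colors M f U v : {set T} :=
  f @: inside M U :\: f @: inside M (U :\ v).

Lemma rainbow_triplesP M f S :
  reflect [/\ #|S| = 3, pairs_of S \subset M & {in pairs_of S &, injective f}]
          (S \in rainbow_triples M f).
Proof.
rewrite inE; apply: (iffP and3P) => [[/eqP ? ? /imset_injP ?] | [-> ? ?]] //.
by split=> //; apply/imset_injP.
Qed.

Lemma pairs_of3 x y z E :
  E \in pairs_of [set x; y; z] ->
  [\/ E = [set x; y], E = [set x; z] | E = [set y; z]].
Proof.
rewrite inE => /andP[/subsetP sES /cards2P[a [b [ab defE]]]].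
have /sES : a \in E by rewrite defE !inE eqxx.
have /sES : b \in E by rewrite defE !inE eqxx orbT.
rewrite defE !inE -!orbA => /or3P[]/eqP eb /or3P[]/eqP ea; subst a b;
  first [by rewrite eqxx in ab | by constructor 1 | by constructor 2
    | by constructor 3 | by constructor 1; rewrite setUC
    | by constructor 2; rewrite setUC | by constructor 3; rewrite setUC].
Qed.

Lemma mem_rainbow_triples M f x y z :
    x != y -> x != z -> y != z ->
    [set x; y] \in M -> [set x; z] \in M -> [set y; z] \in M ->
    f [set x; y] != f [set x; z] -> f [set x; y] != f [set y; z] ->
    f [set x; z] != f [set y; z] ->
  [set x; y; z] \in rainbow_triples M f.
Proof.
move=> xy xz yz Mxy Mxz Myz c1 c2 c3; apply/rainbow_triplesP; split.
- by rewrite setUC cardsU1 cards2 !inE xy eq_sym (negbTE xz) eq_sym (negbTE yz).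
- by apply/subsetP=> E /pairs_of3[]->.
by move=> E F /pairs_of3[]-> /pairs_of3[]-> // /eqP; rewrite ?(negbTE c1) ?(negbTE c2) ?(negbTE c3)
  // eq_sym ?(negbTE c1) ?(negbTE c2) ?(negbTE c3).
Qed.

(** * Edges plus colors in the absence of rainbow triangles *)

Section NoRainbow.

Variables (M : {set {set V}}) (f : {set V} -> T).
Hypothesis card_edge : forall E, E \in M -> #|E| = 2.
Hypothesis no_rainbow : rainbow_triples M f = set0.

Lemma edge_neq x y : [set x; y] \in M -> x != y.
Proof. by move=> /card_edge; rewrite cards2; case: eqP. Qed.

Lemma edge_at U v E : E \in inside M U -> E \notin inside M (U :\ v) ->
  exists2 x, x \in neighbors M U v & E = [set v; x].
Proof.
rewrite !inE => /andP[EM EU]; rewrite EM subsetD1 EU /= negbK => vE.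
have /eqP/cards2P[a [b [_ defE]]] := card_edge _ EM.
have aU : a \in U by apply: (subsetP EU); rewrite defE !inE eqxx.
have bU : b \in U by apply: (subsetP EU); rewrite defE !inE eqxx orbT.
move: vE; rewrite {1}defE !inE => /orP[]/eqP->.
  by exists b; rewrite // inE bU -defE.
by exists a; rewrite ?inE setUC // aU -defE.
Qed.

Lemma card_inside_del U v :
  #|inside M U| <= #|inside M (U :\ v)| + #|neighbors M U v|.
Proof.
apply: leq_trans (leq_add (leqnn _) (leq_imset_card (fun x => [set v; x]) _)).
apply: leq_trans (leq_card_setU _ _); apply/subset_leq_card/subsetP=> E EU.
rewrite inE; case: (boolP (E \in inside M (U :\ v))) => //= nE.
by have [x xN ->] := edge_at _ _ _ EU nE; apply: imset_f.
Qed.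

Lemma card_colors_del U v :
  #|f @: inside M U| <= #|f @: inside M (U :\ v)| + #|lost_colors M f U v|.
Proof.
apply: leq_trans (leq_card_setU _ _); apply/subset_leq_card/subsetP=> c.
by rewrite !inE => ->; rewrite andbT orbN.
Qed.

Lemma lost_color_neighbor U v c : c \in lost_colors M f U v ->
  exists2 x, x \in neighbors M U v & f [set v; x] = c.
Proof.
rewrite inE => /andP[nc /imsetP[E EU defc]].
have [|x xN defE] := edge_at U v E EU; last by exists x; rewrite // -defE.
by apply: contra nc; rewrite defc; apply: imset_f.
Qed.

(** One neighbor is picked per lost color. An edge joining two of them avoids [v], so its color
    survives the deletion of [v] and differs from both lost colors: a rainbow triangle would
    arise. *)
Lemma lost_colors_transversal U v : exists X : {set V},
  [/\ X \subset neighbors M U v, #|X| = #|lost_colors M f U v| &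
      forall a b, a \in X -> b \in X -> [set a; b] \notin M].
Proof.
(* The default [v] is never reached on a lost color, which always occurs on an edge at [v]. *)
pose x c := odflt v [pick x in neighbors M U v | f [set v; x] == c].
have xP c : c \in lost_colors M f U v ->
    x c \in neighbors M U v /\ f [set v; x c] = c.
  move=> /lost_color_neighbor[y yN yc]; rewrite /x.
  by case: pickP => [z /andP[zN /eqP]| /(_ y)]; rewrite //= yN yc eqxx.
exists (x @: lost_colors M f U v); split.
- by apply/subsetP=> _ /imsetP[c /xP[? _] ->].
- by apply: card_in_imset => c d /xP[_ ec] /xP[_ ed] xcd; rewrite -ec xcd ed.
move=> _ _ /imsetP[c cL ->] /imsetP[d dL ->]; apply/negP=> abM.
have [/[!inE]/andP[aU vaM] fa] := xP c cL.
have [/[!inE]/andP[bU vbM] fb] := xP d dL.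
have ab := edge_neq _ _ abM; have va := edge_neq _ _ vaM; have vb := edge_neq _ _ vbM.
have fab : f [set x c; x d] \in f @: inside M (U :\ v).
  apply: imset_f; rewrite inE abM; apply/subsetP=> y; rewrite !inE.
  by case/orP=> /eqP->; rewrite eq_sym ?va ?vb.
suff: [set v; x c; x d] \in rainbow_triples M f by rewrite no_rainbow inE.
apply: mem_rainbow_triples => //; rewrite ?fa ?fb.
- by apply: contra ab => /eqP->.
- by apply: contraTneq cL => ->; rewrite inE fab.
by apply: contraTneq dL => ->; rewrite inE fab.
Qed.

Lemma exists_low_vertex U : U != set0 ->
  exists2 v, v \in U & #|neighbors M U v| + #|lost_colors M f U v| <= #|U|.
Proof.
case/set0Pn=> u uU; apply/exists_inP; apply/contraT.
rewrite negb_exists_in => /forall_inP high.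
have {}high v : v \in U -> #|U| < #|neighbors M U v| + #|lost_colors M f U v|.
  by move=> /high; rewrite -ltnNge.
case: (arg_maxnP (fun v => #|lost_colors M f U v|) uU) => v vU vmax.
have [X [XN cardX indep]] := lost_colors_transversal U v.
have XU : X \subset U.
  by apply/subsetP=> a /(subsetP XN); rewrite inE => /andP[].
(* The degree of [v] is at most [#|U|], so the failed bound forces s(v) > 0. *)
have : X != set0.
  have : #|neighbors M U v| <= #|U| by apply/subset_leq_card/subsetP=> a /[!inE]/andP[].
  by move=> leN; rewrite -card_gt0 cardX; have := high v vU; lia.
case/set0Pn=> a aX; have aU := subsetP XU a aX.
(* As [a] lies in [X], its neighbors avoid [X]; the failed bound at [a] then gives s(a) > s(v),
   against the choice of [v]. *)
have : #|neighbors M U a| <= #|U :\: X|.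
  apply/subset_leq_card/subsetP=> b /[!inE]/andP[-> abM]; rewrite andbT.
  by apply: contraL abM; apply: indep.
rewrite cardsDS // cardX; have := vmax a aU; have := high a aU.
have := subset_leq_card XU; rewrite cardX /=; lia.
Qed.

Lemma no_rainbow_bound U : U != set0 ->
  #|inside M U| + #|f @: inside M U| < 'C(#|U|.+1, 2).
Proof.
have [n] := ubnP #|U|; elim: n U => // n IHn U leUn U0.
have [v vU low] := exists_low_vertex U U0.
have cardU : #|U| = #|U :\ v|.+1 by rewrite (cardsD1 v) vU.
(* The induction hypothesis asks for a nonempty set, so a single vertex is treated apart. *)
have [Uv0 | Uv0] := eqVneq (U :\ v) set0.
  suff -> : inside M U = set0 by rewrite imset0 !cards0 cardU Uv0 cards0.
  apply/setP=> E; rewrite !inE; apply/andP=> -[/card_edge cE /subset_leq_card].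
  by rewrite cE cardU Uv0 cards0.
(* By Pascal's rule the binomial grows by exactly [#|U|], the most that deleting [v] can cost. *)
have := IHn (U :\ v) ltac:(lia) Uv0; rewrite -cardU binS bin1.
have := card_inside_del U v; have := card_colors_del U v; lia.
Qed.

End NoRainbow.

(** * Destroying rainbow triangles one at a time *)

Lemma destroy_rainbow_triple M f : rainbow_triples M f != set0 ->
  exists M' f', [/\ M' \subset M,
    #|M| + #|f @: M| <= (#|M'| + #|f' @: M'|).+1 &
    rainbow_triples M' f' \proper rainbow_triples M f].
Proof.
case/set0Pn=> S SR; have /rainbow_triplesP[cardS pM injf] := SR.
have [E [F [EF ES FS]]] : exists E F, [/\ E != F, E \in pairs_of S & F \in pairs_of S].
  have : 1 < #|pairs_of S| by rewrite cards_draws cardS.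
  by case/card_gt1P=> E [F [ES FS EF]]; exists E, F.
have EM := subsetP pM E ES; have FM := subsetP pM F FS.
have [dup | uniqE] := boolP (f E \in f @: (M :\ E)).
  (* Another edge carries the color of [E], so deleting [E] loses no color. *)
  exists (M :\ E), f; split; first exact: subD1set.
    rewrite [#|M|](cardsD1 E) EM add1n addSn ltnS leq_add2l.
    apply/subset_leq_card/subsetP=> _ /imsetP[G GM ->].
    by have [-> // | GE] := eqVneq G E; apply: imset_f; rewrite !inE GE.
  apply/properP; split; last first.
    exists S => //; apply/rainbow_triplesP=> -[_ /subsetP/(_ E ES)].
    by rewrite !inE eqxx.
  apply/subsetP=> R /rainbow_triplesP[cR pR iR]; apply/rainbow_triplesP.
  by split=> //; apply: subset_trans pR (subD1set _ _).
(* Recoloring loses at most the color [f E], and [S] is no longer rainbow because [E] and [F] now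
   agree. *)
pose f' G := if G == E then f F else f G.
exists M, f'; split=> //.
  rewrite -addnS leq_add2l -{1}(setD1K EM) imsetU1 cardsU1.
  rewrite uniqE add1n ltnS; apply/subset_leq_card/subsetP=> _ /imsetP[G /[!inE]/andP[GE GM] ->].
  apply/imsetP; exists G => //.
  by rewrite /f' (negbTE GE).
apply/properP; split; last first.
  exists S => //; apply/rainbow_triplesP=> -[_ _ /(_ E F ES FS)].
  by rewrite /f' eqxx eq_sym (negbTE EF) => /(_ erefl) EqF; rewrite EqF eqxx in EF.
apply/subsetP=> R /rainbow_triplesP[cR pR iR]; apply/rainbow_triplesP; split=> //.
(* Only [E] has color [f E], so giving [E] its old color back creates no repetition in [R]. *)
have solo G : G \in pairs_of R -> f G = f E -> G = E.
  move=> GR fG; apply/eqP; apply: contraR uniqE => GE; rewrite -fG.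
  by apply: imset_f; rewrite !inE GE (subsetP pR).
move=> G H GR HR fGH.
have [GE | GE] := eqVneq G E.
  by rewrite [H]solo // -fGH GE.
have [HE | HE] := eqVneq H E.
  by rewrite HE; apply: solo; rewrite // fGH HE.
by apply: iR; rewrite // /f' (negbTE GE) (negbTE HE).
Qed.

(** Each destroyed triple uses up at most one unit of the surplus [k]; at surplus 0 the strict bound
    [no_rainbow_bound] still yields one more triple. *)
Lemma rainbow_triples_bound M f k :
    0 < #|V| -> (forall E, E \in M -> #|E| = 2) ->
    'C(#|V|.+1, 2) + k <= #|M| + #|f @: M| ->
  k < #|rainbow_triples M f|.
Proof.
move=> V0; elim: k M f => [|k IHk] M f card2 large;
  (have R0 : rainbow_triples M f != set0;
    [apply/eqP=> R0; have := no_rainbow_bound M f card2 R0 [set: V];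
     have -> : inside M setT = M by apply/setP=> E; rewrite !inE subsetT andbT
    |]).
- by rewrite -card_gt0 cardsT => /(_ V0); lia.
- by rewrite card_gt0.
- by rewrite -card_gt0 cardsT => /(_ V0); lia.
have [M' [f' [sM le /proper_card lt]]] := destroy_rainbow_triple M f R0.
apply: leq_ltn_trans lt; apply: IHk => [E /(subsetP sM)/card2 // |]; lia.
Qed.

End Sets.

(** * Transfer to edge-colored graphs *)

Section ColorClasses.

Context {V : finType} {C : eqType}.
Variable G : edge_colored_graph V C.

(* Replaces the color by its class, so that colors range over a [finType]. *)
Definition color_class (E : {set V}) : {set {set V}} :=
  [set F in edges G | color G F == color G E].

(** The edge [E] belongs to its own class, hence to that of [F]. *)
Lemma color_class_eq E F : E \in edges G ->
  color_class E = color_class F -> color G E = color G F.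
Proof. by move=> EG /setP/(_ E); rewrite [LHS]inE [RHS]inE EG eqxx /= => /esym/eqP. Qed.

(** Mapping a color to its class is injective on the colors that occur, since their classes are
    nonempty. *)
Lemma num_colorsE : num_colors G = #|color_class @: edges G|.
Proof.
pose cls c := [set F in edges G | color G F == c].
pose cs := undup [seq color G E | E in edges G].
have csP c : c \in cs -> exists2 E, E \in edges G & c = color G E.
  by rewrite mem_undup => /imageP.
have <- : [set X in map cls cs] = color_class @: edges G.
  apply/setP=> X; rewrite inE; apply/mapP/imsetP=> [[c /csP[E EG ->] ->] | [E EG ->]].
    by exists E.
  by exists (color G E); rewrite // mem_undup; apply: image_f.
rewrite cardsE (card_uniqP _) ?size_map // map_inj_in_uniq ?undup_uniq //.
by move=> c d /csP[E EG ->] /csP[F FG ->]; apply: color_class_eq.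
Qed.

Lemma edges_adj x y : [set x; y] \in edges G -> G x y.
Proof.
rewrite inE => /existsP[a /existsP[b /andP[ab /eqP e]]].
have aN : a != b by apply: contraTneq ab => ->; rewrite adj_irrefl.
have : a \in [set x; y] by rewrite e !inE eqxx.
have : b \in [set x; y] by rewrite e !inE eqxx orbT.
rewrite !inE => /orP[]/eqP eb /orP[]/eqP ea; subst a b; rewrite ?eqxx // in aN *.
by rewrite adj_sym.
Qed.

Lemma card_edges E : E \in edges G -> #|E| = 2.
Proof.
rewrite inE => /existsP[x /existsP[y /andP[xy /eqP->]]]; rewrite cards2.
by case: eqP xy => // ->; rewrite adj_irrefl.
Qed.

Lemma rainbow_triples_sub :
  rainbow_triples (edges G) color_class \subset rainbow_triangles G.
Proof.
apply/subsetP=> S /rainbow_triplesP[cS pS iS]; rewrite inE /triangle cS eqxx /=.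
apply/andP; split.
  apply/forall_inP=> x xS; apply/forall_inP=> y yS; apply/implyP=> xy.
  apply/edges_adj/(subsetP pS); rewrite inE cards2 xy andbT.
  by apply/subsetP=> z; rewrite !inE => /orP[]/eqP->.
have pE E : E \in edges_within G S -> E \in pairs_of S.
  by rewrite inE => /andP[/card_edges cE sES]; rewrite inE cE sES.
apply/forall_inP=> E ES; apply/forall_inP=> F FS; apply/implyP.
apply: contra => /eqP cEF; apply/eqP/iS; rewrite ?pE //.
by apply/setP=> X; rewrite !inE cEF.
Qed.

End ColorClasses.

Theorem theorem2 (k n : nat) (V : finType) (C : eqType)
    (G : edge_colored_graph V C) (k_gt0 : 0 < k) (n_gt0 : 0 < n)
    (cardV : #|V| = n)
    (hG : 'C(n.+1, 2) + k - 1 <= num_edges G + num_colors G) :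
  k <= #|rainbow_triangles G|.
Proof.
apply: leq_trans (subset_leq_card (rainbow_triples_sub G)).
rewrite -[k]prednK //; apply: rainbow_triples_bound.
- by rewrite cardV.
- exact: card_edges.
move: hG; rewrite num_colorsE /num_edges cardV; lia.
Qed.
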